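(* Let $n \geq 3$ and let $K \subset \mathbb{R}^n$ be a convex body which is unconditional and permutationally invariant. For each $i = 1, \ldots, n$ let $K_i$ be the orthogonal projection of $K$ onto the subspace $\{(x_1, \ldots, x_n) \in \mathbb{R}^n : x_{i+1} = \ldots = x_n = 0\}$, regarded as a convex body in $\mathbb{R}^i$ (so $K_n = K$), and let $|K_i|$ denote its $i$-dimensional volume. Then the sequence $(|K_i|)_{i=1}^n$ is log-concave, i.e. $|K_i|^2 \geq |K_{i-1}| \cdot |K_{i+1}|$ for every $i = 2, \ldots, n-1$. In particular, $$|K_{n-1}|^2 \geq |K_n| \cdot |K_{n-2}|.$$
   Context: A convex body in $\mathbb{R}^n$ is a compact convex set with nonempty interior. A convex body $K$ in $\mathbb{R}^n$ is called unconditional if for every point $(x_1, \ldots, x_n) \in K$ and every choice of signs $\epsilon_1, \ldots, \epsilon_n \in \{-1, 1\}$ the point $(\epsilon_1 x_1, \ldots, \epsilon_n x_n)$ also belongs to $K$. A convex body $K$ in $\mathbb{R}^n$ is called permutationally invariant if for every point $(x_1, \ldots, x_n) \in K$ and every permutation $\pi$ of $\{1, \ldots, n\}$ the point $(x_{\pi(1)}, \ldots, x_{\pi(n)})$ also belongs to $K$. A sequence $(a_i)_{i=1}^n$ of positive real numbers is called log-concave if $a_i^2 \geq a_{i-1}a_{i+1}$ for $i = 2, \ldots, n-1$. The subspace $\{x_{i+1} = \ldots = x_n = 0\}$ is identified with $\mathbb{R}^i$ via the first $i$ coordinates, and volume in $\mathbb{R}^i$ is $i$-dimensional Lebesgue measure.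 *)

(* Defs.v *)
From HB Require Import structures.
From mathcomp Require Import all_boot all_order all_algebra all_fingroup.
From mathcomp Require Import all_classical all_reals all_analysis.

Set Implicit Arguments.
Unset Strict Implicit.
Unset Printing Implicit Defensive.
Import Order.TTheory GRing.Theory Num.Theory numFieldNormedType.Exports.
Local Open Scope classical_set_scope.
Local Open Scope ring_scope.

(* Lebesgue measure on R^n, as the n-fold product of lebesgue_measure, carried
   by n.-tuple because the library equips tuples (but not row vectors) with
   the product sigma-algebra. Products are transported along
   R * R^n -> R^n.+1; lebesgue_tuple_box gives the value on boxes. *)
Section lebesgue_tuple.
Context {R : realType}.
Local Notation RT := (measurableTypeR R).
Local Open Scope ereal_scope.

Definition tcons n (p : RT * n.-tuple RT) : n.+1.-tuple RT :=
  [tuple of p.1 :: p.2].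

Lemma measurable_tcons n : measurable_fun [set: RT * n.-tuple RT] (@tcons n).
Proof. by apply: measurable_cons. Qed.

Definition tuncons n (t : n.+1.-tuple RT) : RT * n.-tuple RT :=
  (tnth t ord0, [tuple of behead t]).

Lemma measurable_tuncons n :
  measurable_fun [set: n.+1.-tuple RT] (@tuncons n).
Proof.
by apply: measurable_fun_pair; [exact: measurable_tnth|exact: measurable_behead].
Qed.

Lemma tconsK n : cancel (@tcons n) (@tuncons n).
Proof.
by case=> x t; congr pair; apply: val_inj.
Qed.

Section step.
Variables (n : nat) (m : {sigma_finite_measure set (n.-tuple RT) -> \bar R}).

Definition lebesgue_cons : set (n.+1.-tuple RT) -> \bar R :=
  pushforward (@lebesgue_measure R \x m) (@tcons n).

HB.instance Definition _ := Measure.copy lebesgue_cons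
  (measure_function_pushforward__canonical__measure_function_Measure
     (@lebesgue_measure R \x m) (@measurable_tcons n)).

Let sigma_finite_lebesgue_cons : sigma_finite setT lebesgue_cons.
Proof.
have /sigma_finiteP[F [FT ndF Foo]] := sigma_finiteT (@lebesgue_measure R).
have /sigma_finiteP[G [GT ndG Goo]] := sigma_finiteT m.
exists (fun k => @tuncons n @^-1` (F k `*` G k)).
  rewrite -preimage_bigcup (_ : \bigcup_k _ = setT) ?preimage_setT//.
  apply/seteqP; split=> // -[x t] _.
  have [i _ Fix] : (\bigcup_k F k) x by rewrite -FT.
  have [j _ Gjt] : (\bigcup_k G k) t by rewrite -GT.
  exists (maxn i j) => //; split => /=.
    by move: x Fix; exact/subsetPset/ndF/leq_maxl.
  by move: t Gjt; exact/subsetPset/ndG/leq_maxr.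
move=> k; have [mF Fk] := Foo k; have [mG Gk] := Goo k; split.
  rewrite -[X in measurable X]setTI.
  by apply: measurable_tuncons => //; exact: measurableX.
rewrite /lebesgue_cons /pushforward -comp_preimage.
rewrite (_ : _ \o _ = id); last by apply/funext => p /=; exact: tconsK.
rewrite preimage_id (product_measure1E (@lebesgue_measure R) m)//.
by rewrite lte_mul_pinfty// ge0_fin_numE.
Qed.

HB.instance Definition _ := Measure_isSigmaFinite.Build _ _ _ lebesgue_cons
  sigma_finite_lebesgue_cons.

End step.

Fixpoint lebesgue_tuple n :
    {sigma_finite_measure set (n.-tuple RT) -> \bar R} :=
  match n with
  | 0 => \d_([tuple] : 0.-tuple RT)
  | n'.+1 => lebesgue_cons (lebesgue_tuple n')
  end.

Lemma measurable_box n (A : 'I_n -> set RT) : (forall i, measurable (A i)) ->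
  measurable [set t : n.-tuple RT | forall i, A i (tnth t i)].
Proof.
move=> mA; rewrite (_ : mkset _ =
  \bigcap_(i in [set: 'I_n]) ((fun t : n.-tuple RT => tnth t i) @^-1` A i)).
  apply: fin_bigcap_measurable => // i _.
  by rewrite -[X in measurable X]setTI; exact: measurable_tnth.
by apply/seteqP; split=> t /= tA i; [move=> _; exact: tA|exact: tA].
Qed.

Lemma lebesgue_tuple_box n (A : 'I_n -> set RT) :
  (forall i, measurable (A i)) ->
  lebesgue_tuple n [set t | forall i, A i (tnth t i)] =
  \prod_(i < n) lebesgue_measure (A i).
Proof.
elim: n A => [|n IH] A mA.
  by rewrite big_ord0 /= diracE mem_set//=; case.
rewrite big_ord_recl -IH//.
rewrite -(product_measure1E (@lebesgue_measure R) (lebesgue_tuple n))//;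
  last exact: (@measurable_box n (fun i => A (lift ord0 i))).
rewrite /= /lebesgue_cons /pushforward; congr ((_ \x _) _).
apply/seteqP; split=> -[x t] /=.
  move=> tA; split=> [|i]; first exact: (tA ord0).
  by have := tA (lift ord0 i); rewrite tnthS.
by case=> xA tA i; have [j ->|->//] := unliftP ord0 i; rewrite tnthS.
Qed.

End lebesgue_tuple.

Section convex_bodies.
Context {R : realType}.

(* fine sends +oo to 0; a positive volume is thus a finite measure *)
Definition volume n (A : set 'rV[R]_n) : R :=
  fine (lebesgue_tuple n
    [set t : n.-tuple (measurableTypeR R) | A (\row_i tnth t i)]).

Definition convex_body n (K : set 'rV[R]_n) : Prop :=
  [/\ compact K, convex_set (K : set (convex_lmodType 'rV[R]_n)) & K° !=set0].

Definition unconditional n (K : set 'rV[R]_n) : Prop :=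
  forall (x : 'rV[R]_n) (eps : 'I_n -> R),
    (forall i, eps i = -1 \/ eps i = 1) -> K x -> K (\row_i (eps i * x 0 i)).

Definition perm_invariant n (K : set 'rV[R]_n) : Prop :=
  forall (x : 'rV[R]_n) (s : 'S_n), K x -> K (\row_i x 0 (s i)).

Definition orthoproj n i (x : 'rV[R]_n) : 'rV[R]_n :=
  \row_(j < n) if (j < i)%N then x 0 j else 0.

(* the inclusion of R^i into R^n (for i <= n) as the first i coordinates *)
Definition coord_incl i n (y : 'rV[R]_i) : 'rV[R]_n :=
  \row_(j < n) if insub (val j) is Some k then y 0 k else 0.

(* K_i, as a subset of R^i; only meaningful for i <= n *)
Definition coord_proj n i (K : set 'rV[R]_n) : set 'rV[R]_i :=
  coord_incl n @^-1` (orthoproj i @` K).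

Lemma coord_proj_id n (K : set 'rV[R]_n) : @coord_proj n n K = K.
Proof.
have incl_id (y : 'rV[R]_n) : coord_incl n y = y.
  by apply/rowP => j; rewrite mxE valK.
have proj_id (x : 'rV[R]_n) : orthoproj n x = x.
  by apply/rowP => j; rewrite mxE ltn_ord.
apply/seteqP; split=> y; rewrite /coord_proj /= incl_id.
  by move=> [x Kx]; rewrite proj_id => <-.
by move=> Ky; exists y; rewrite ?proj_id.
Qed.

(* log-concavity of the finite sequence a 1, ..., a n of positive reals *)
Definition log_concave n (a : nat -> R) : Prop :=
  (forall i, (1 <= i <= n)%N -> 0 < a i) /\
  (forall i, (2 <= i <= n.-1)%N -> a i.-1 * a i.+1 <= a i ^+ 2).

End convex_bodies.

Arguments coord_proj {R n} i K _.

(* Main.v *)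
Require Import Defs.
From HB Require Import structures.
From mathcomp Require Import all_boot all_order all_algebra all_fingroup.
From mathcomp Require Import all_classical all_reals all_analysis.
From mathcomp Require Import measurable_realfun zify ring lra.

(* Write a_k = |K_k| and let C be the unit cube. The symmetries of K give
   the Steiner formula |sK + t/2 [-1,1]^m| = sum_k binom(m,k) s^k t^(m-k) a_k
   for the m-dimensional section of K, i.e. the mixed volumes of K and C are the
   a_k, and the claim is Minkowski's second inequality
   V(K[m-1], C)^2 >= V(K[m]) V(K[m-2], C, C). It follows from the
   multiplicative Brunn-Minkowski inequality at the midpoint of K and
   (1 - 2cx)K + x[-1,1]^m, where c = a_(m-1)/a_m makes the Steiner polynomial
   stationary at x = 0, by comparing second-order terms as x -> 0. *)

Set Implicit Arguments.
Unset Strict Implicit.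
Unset Printing Implicit Defensive.

Import Order.TTheory GRing.Theory Num.Theory numFieldNormedType.Exports.
Local Open Scope classical_set_scope.
Local Open Scope ring_scope.

(** * Brunn-Minkowski and Prékopa-Leindler inequalities on the line *)

Section one_dimensional.
Context {R : realType}.
Local Notation RT := (measurableTypeR R).
Local Notation mu := (@lebesgue_measure R).

(** [A] and [B] lie in the symmetric intervals of half-lengths [sup A] and [sup B], while [C], being
    balanced, contains the open symmetric interval whose half-length [g] is the weighted mean of
    these suprema. *)
Lemma brunn_minkowski1 (s t : R) (A B C : set R) :
  0 < s -> 0 < t -> measurable A -> measurable B -> measurable C ->
  has_ubound A -> has_ubound B -> A 0 -> B 0 ->
  (forall x, A x -> A `|x|) -> (forall x, B x -> B `|x|) ->
  (forall x y, `|x| <= `|y| -> C y -> C x) ->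
  (forall x y, A x -> B y -> C ((s * x + t * y) / (s + t))) ->
  (s%:E * mu A + t%:E * mu B <= (s + t)%:E * mu C)%E.
Proof.
move=> s0 t0 mA mB mC ubA ubB A0 B0 Aabs Babs Cbal ABC.
have hsA : has_sup A by split => //; exists 0.
have hsB : has_sup B by split => //; exists 0.
have mule (D : set R) : measurable D -> has_sup D -> D 0 ->
    (forall x, D x -> D `|x|) ->
    0 <= sup D /\ (mu D <= (2 * sup D)%:E)%E.
  move=> mD hsD D0 Dabs; have sD0 : 0 <= sup D by exact: ub_le_sup hsD.2 _ D0.
  split => //; apply: (@le_trans _ _ (mu `[- sup D, sup D])).
    apply: le_measure; rewrite ?inE//= => x /Dabs Dx /=.
    by rewrite in_itv/= -ler_norml; exact: ub_le_sup hsD.2 _ Dx.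
  rewrite lebesgue_measure_itv/= lte_fin.
  case: ifPn => _; last by rewrite lee_fin mulr_ge0.
  by rewrite -EFinB lee_fin; lra.
have [sA0 muA] := mule _ mA hsA A0 Aabs.
have [sB0 muB] := mule _ mB hsB B0 Babs.
pose g := (s * sup A + t * sup B) / (s + t).
have st0 : 0 < s + t by exact: addr_gt0.
have gE : g * (s + t) = s * sup A + t * sup B by rewrite divfK// gt_eqF.
have g0 : 0 <= g.
  by apply: divr_ge0 (ltW st0); rewrite addr_ge0// mulr_ge0// ltW.
have muC : ((2 * g)%:E <= mu C)%E.
  apply: (@le_trans _ _ (mu `]- g, g[)).
    rewrite lebesgue_measure_itv/= lte_fin; case: ifPn => h.
      by rewrite -EFinB lee_fin; lra.
    by rewrite lee_fin; lra.
  apply: le_measure; rewrite ?inE//= => z /=.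
  rewrite in_itv/= -ltr_norml => zg.
  (* Points within [e] of both suprema have weighted mean at least [g - e], which is the absolute
     value of [z]. *)
  pose e := g - `|z|; have e0 : 0 < e by rewrite subr_gt0.
  have [x Ax xe] := sup_adherent e0 hsA.
  have [y By ye] := sup_adherent e0 hsB.
  apply: (Cbal _ _ _ (ABC _ _ Ax By)).
  apply: le_trans (ler_norm _); rewrite ler_pdivlMr//.
  have : s * (sup A - e) + t * (sup B - e) <= s * x + t * y.
    by rewrite lerD// ler_wpM2l// ltW.
  by move: gE; rewrite /e; lra.
have /le_trans : (s%:E * mu A + t%:E * mu B <=
    s%:E * (2 * sup A)%:E + t%:E * (2 * sup B)%:E)%E.
  by rewrite leeD// lee_wpmul2l// lee_fin ltW.
apply; apply: (@le_trans _ _ ((s + t)%:E * (2 * g)%:E)%E).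
  by rewrite -!EFinM -EFinD lee_fin; move: gE; lra.
by rewrite lee_wpmul2l// lee_fin ltW.
Qed.

Lemma measurable_hypograph (f : R -> R) : measurable_fun setT f ->
  measurable [set z : RT * RT | z.2 < f z.1].
Proof.
move=> mf; rewrite -[X in measurable X]setTI.
have mlt : measurable_fun setT (fun z : RT * RT => z.2 < f z.1).
  apply: measurable_fun_ltr; first exact: measurable_snd.
  exact: measurableT_comp mf measurable_fst.
by have := mlt measurableT [set true] I; rewrite setTI.
Qed.

Lemma measurable_superlevel (f : R -> R) (r : R) : measurable_fun setT f ->
  measurable [set x : RT | r < f x].
Proof.
move=> mf; rewrite -[X in measurable X]setTI.
rewrite (_ : [set x | _] = f @^-1` `]r, +oo[); first exact: mf.
by apply/seteqP; split => x /=; rewrite in_itv/= andbT.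
Qed.

Lemma measurable_superlevel_measure (f : R -> R) : measurable_fun setT f ->
  measurable_fun setT (fun r : RT => mu [set x | r < f x]).
Proof.
move=> mf; have := measurable_fun_ysection mu (measurable_hypograph mf).
congr measurable_fun; apply/funext => r/=; congr (mu _).
by apply/seteqP; split => x; rewrite /ysection/= inE.
Qed.

(** Tonelli for the region [0 <= r < f x]: vertical sections have length [f x], horizontal ones are
    the superlevel sets. *)
Lemma layer_cake (f : R -> R) : measurable_fun setT f -> (forall x, 0 <= f x) ->
  (\int[mu]_x (f x)%:E =
   \int[mu]_(r in [set r : R | (0 <= r)%R]) mu [set x | (r < f x)%R])%E.
Proof.
move=> mf f0.
pose A := [set z : RT * RT | 0 <= z.2 /\ z.2 < f z.1].
have mA : measurable A.
  rewrite (_ : A = [set z | 0 <= z.2] `&` [set z | z.2 < f z.1])//.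
  apply: measurableI.
    rewrite -[X in measurable X]setTI.
    rewrite (_ : [set z : RT * RT | 0 <= z.2] = snd @^-1` `[0, +oo[).
      by apply: measurable_snd => //; exact: measurable_itv.
    by apply/seteqP; split => z /=; rewrite in_itv/= andbT.
  exact: measurable_hypograph.
have h := @indic_fubini_tonelli _ _ _ _ R mu mu _ mA.
transitivity (\int[mu]_x mu (xsection A x))%E.
  apply: eq_integral => x _.
  rewrite (_ : xsection A x = `[0, f x[%classic).
    rewrite lebesgue_measure_itv/= lte_fin.
    by case: ltgtP (f0 x) => // [_|<-] _; rewrite ?sube0.
  by apply/seteqP; split => r; rewrite /xsection/= inE /A/= in_itv/= => /andP.
transitivity (\int[mu]_r mu (ysection A r))%E.
  by move: h; rewrite indic_fubini_tonelli_FE// indic_fubini_tonelli_GE.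
rewrite [RHS]integral_mkcond; apply: eq_integral => r _.
rewrite patchE; case: ifPn; rewrite (inE, notin_setE)/= => r0.
  congr (mu _); apply/seteqP; split => x; rewrite /ysection/= inE /A/= => //.
  by case.
rewrite (_ : ysection _ _ = set0) ?measure0//; apply/seteqP; split => x //.
by rewrite /ysection/= inE /A/= => -[] /r0.
Qed.
(** Even and nonincreasing in the absolute value, so that superlevel sets are intervals symmetric
    about 0; bounded support makes those at nonnegative levels bounded. *)
Definition radial_profile (f : R -> R) : Prop :=
  [/\ measurable_fun setT f, forall x, 0 <= f x,
      forall x y, `|x| <= `|y| -> f y <= f x &
      exists M, forall x, M < `|x| -> f x = 0].

Lemma radial_profileZ (a : R) (f : R -> R) : 0 <= a ->
  radial_profile f -> radial_profile (fun x => a * f x).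
Proof.
move=> a0 [mf f0 fr [M fM]]; split.
- exact: measurable_funM.
- by move=> x; exact: mulr_ge0.
- by move=> x y /fr xy; exact: ler_wpM2l.
- by exists M => x /fM ->; rewrite mulr0.
Qed.

(** With both maxima equal to 1, the superlevel sets of [f] and [g] are nonempty for the same
    levels. Applying [brunn_minkowski1] at each level and integrating over levels gives an additive
    inequality. *)
Lemma prekopa_leindler_normalized (s t : R) (f g h : R -> R) (If Ig Ih : R) :
  0 < s -> 0 < t ->
  radial_profile f -> radial_profile g -> radial_profile h ->
  f 0 = 1 -> g 0 = 1 ->
  (forall x y, f x * g y <= h ((s * x + t * y) / (s + t)) ^+ 2) ->
  (\int[mu]_x (f x)%:E = If%:E)%E -> (\int[mu]_x (g x)%:E = Ig%:E)%E ->
  (\int[mu]_x (h x)%:E = Ih%:E)%E ->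
  s * If + t * Ig <= (s + t) * Ih.
Proof.
move=> s0 t0 [mf f0 fr [M fM]] [mg g0 gr [N gN]] [mh h0 hr _].
move=> f1 g1 fgh If' Ig' Ih'.
have st0 : 0 < s + t by exact: addr_gt0.
rewrite -lee_fin EFinD !EFinM -If' -Ig' -Ih' !layer_cake//.
have mD : measurable [set r : RT | 0 <= r].
  rewrite (_ : [set _ | _] = `[0, +oo[%classic); first exact: measurable_itv.
  by apply/seteqP; split => z /=; rewrite in_itv/= andbT.
have msup (k : R -> R) : measurable_fun setT k ->
    measurable_fun [set r : RT | 0 <= r] (fun r : RT => mu [set x | r < k x]).
  by move=> mk; apply: measurable_funTS; exact: measurable_superlevel_measure.
rewrite -!ge0_integralZl// ?lee_fin ?(ltW s0) ?(ltW t0) ?(ltW st0)//;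
  [|exact: msup|exact: msup|exact: msup].
rewrite -ge0_integralD//; last 4 first.
- by move=> r _; rewrite mule_ge0// lee_fin ltW.
- by apply: measurable_funeM; exact: msup.
- by move=> r _; rewrite mule_ge0// lee_fin ltW.
- by apply: measurable_funeM; exact: msup.
apply: ge0_le_integral => //.
- by move=> r _; rewrite adde_ge0// mule_ge0// lee_fin ltW.
- by apply: emeasurable_funD; apply: measurable_funeM; exact: msup.
- by apply: measurable_funeM; exact: msup.
(* At levels [r >= 1] the sets of [f] and [g] are empty and the left side is 0. *)
move=> r /= r0; have [r1|r1] := ltP r 1; last first.
  have empty (k : R -> R) : (forall x y, `|x| <= `|y| -> k y <= k x) ->
      k 0 = 1 -> [set x | r < k x] = set0.
    move=> kr k1; apply/seteqP; split => // x /= rx.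
    have : k x <= k 0 by apply: kr; rewrite normr0.
    by rewrite k1 => /(lt_le_trans rx); rewrite ltNge r1.
  rewrite (empty f)// (empty g)// !measure0 !mule0 adde0.
  by rewrite mule_ge0// lee_fin ltW.
have ub (k : R -> R) L : (forall x, L < `|x| -> k x = 0) ->
    has_ubound [set x | r < k x].
  move=> kL; exists L => x /= rx; rewrite leNgt; apply/negP => Lx.
  by move: rx; rewrite kL ?(lt_le_trans Lx (ler_norm x))// ltNge r0.
apply: brunn_minkowski1 => //; try exact: measurable_superlevel.
- exact: ub fM.
- exact: ub gN.
- by rewrite /= f1.
- by rewrite /= g1.
- by move=> x /= /lt_le_trans; apply; apply: fr; rewrite normr_id.
- by move=> x /= /lt_le_trans; apply; apply: gr; rewrite normr_id.
- by move=> x y xy /= /lt_le_trans; apply; exact: hr.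
- move=> x y /= xr yr; rewrite -(@ltr_pXn2r _ 2)// ?nnegrE//.
  by apply: lt_le_trans (fgh x y); rewrite expr2 ltr_pM.
Qed.

(** The linear forms are integrals against Lebesgue measure plus an atom at 0. Dividing [f] and [g]
    by their values at 0, and [h] by the geometric mean [c] of these values, reduces to the
    normalized case; the atoms are compared through [c <= h 0]. *)
Lemma prekopa_leindler1 (s s' t t' : R) (f g h : R -> R) (If Ig Ih : R) :
  0 < s -> 0 < s' -> 0 <= t -> 0 <= t' ->
  radial_profile f -> radial_profile g -> radial_profile h ->
  (forall x y, f x * g y <= h ((s * x + s' * y) / (s + s')) ^+ 2) ->
  (\int[mu]_x (f x)%:E = If%:E)%E -> (\int[mu]_x (g x)%:E = Ig%:E)%E ->
  (\int[mu]_x (h x)%:E = Ih%:E)%E ->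
  (s * If + t * f 0) * (s' * Ig + t' * g 0) <=
    ((s + s') / 2 * Ih + (t + t') / 2 * h 0) ^+ 2.
Proof.
move=> s0 s'0 t0 t'0 pf pg ph fgh If' Ig' Ih'.
have null (k : R -> R) Ik : radial_profile k ->
    (\int[mu]_x (k x)%:E = Ik%:E)%E ->
    k 0 = 0 -> Ik = 0.
  move=> [_ k0 kr _] Ik' k00; apply/eqP; rewrite -eqe -Ik'; apply/eqP.
  apply: integral0_eq => x _; congr EFin; apply/eqP; rewrite eq_le k0 andbT -k00.
  by apply: kr; rewrite normr0.
have fg0 := fgh 0 0; rewrite !mulr0 addr0 mul0r in fg0.
have [[_ f0 _ _] [_ g0 _ _] [mh h0 hr _]] := And3 pf pg ph.
(* A radial profile is maximal at 0, so if it vanishes there it vanishes everywhere. *)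
have [f00|f00] := eqVneq (f 0) 0.
  by rewrite f00 (null _ _ pf If' f00) !mulr0 addr0 mul0r sqr_ge0.
have [g00|g00] := eqVneq (g 0) 0.
  by rewrite g00 (null _ _ pg Ig' g00) !mulr0 addr0 mulr0 sqr_ge0.
have {}f00 : 0 < f 0 by rewrite lt_neqAle eq_sym f00 f0.
have {}g00 : 0 < g 0 by rewrite lt_neqAle eq_sym g00 g0.
pose c := Num.sqrt (f 0 * g 0).
have c2 : c ^+ 2 = f 0 * g 0 by rewrite sqr_sqrtr// mulr_ge0// ltW.
have c0 : 0 < c by rewrite sqrtr_gt0 mulr_gt0.
have ch : c <= h 0 by rewrite -(@ler_pXn2r _ 2)// ?nnegrE ?(ltW c0)// c2.
have scale (k : R -> R) (a Ik : R) : radial_profile k -> 0 < a ->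
    (\int[mu]_x (k x)%:E = Ik%:E)%E ->
    (\int[mu]_x (a^-1 * k x)%:E = (a^-1 * Ik)%:E)%E.
  move=> [mk k0 _ _] a0 Ik'; rewrite EFinM -Ik' -ge0_integralZl//.
  - exact/measurable_EFinP.
  - by move=> x _; rewrite lee_fin.
  - by rewrite lee_fin invr_ge0 ltW.
have inv_ge0 (a : R) : 0 < a -> 0 <= a^-1 by move=> a0; rewrite invr_ge0 ltW.
have norm_fgh x y : (f 0)^-1 * f x * ((g 0)^-1 * g y) <=
    (c^-1 * h ((s * x + s' * y) / (s + s'))) ^+ 2.
  rewrite exprMn exprVn c2 mulrACA -invfM ler_wpM2l// invr_ge0 mulr_ge0// ltW.
have main := prekopa_leindler_normalized s0 s'0
  (radial_profileZ (inv_ge0 _ f00) pf) (radial_profileZ (inv_ge0 _ g00) pg)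
  (radial_profileZ (inv_ge0 _ c0) ph) (mulVf (lt0r_neq0 f00))
  (mulVf (lt0r_neq0 g00)) norm_fgh (scale _ _ _ pf f00 If')
  (scale _ _ _ pg g00 Ig') (scale _ _ _ ph c0 Ih').
set If1 := (f 0)^-1 * If in main; set Ig1 := (g 0)^-1 * Ig in main.
set Ih1 := c^-1 * Ih in main.
have -> : If = f 0 * If1 by rewrite /If1 mulVKf// gt_eqF.
have -> : Ig = g 0 * Ig1 by rewrite /Ig1 mulVKf// gt_eqF.
have Ih1E : Ih = c * Ih1 by rewrite /Ih1 mulVKf// gt_eqF.
have Ige0 (k : R -> R) Ik : (forall x, 0 <= k x) ->
    (\int[mu]_x (k x)%:E = Ik%:E)%E -> 0 <= Ik.
  move=> k0 Ik'; rewrite -lee_fin -Ik'; apply: integral_ge0 => x _.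
  by rewrite lee_fin.
have Ifge0 : 0 <= If1 by rewrite mulr_ge0 ?inv_ge0// (Ige0 f).
have Igge0 : 0 <= Ig1 by rewrite mulr_ge0 ?inv_ge0// (Ige0 g).
pose A := s * If1 + t; pose B := s' * Ig1 + t'.
have A0 : 0 <= A by rewrite addr_ge0// mulr_ge0// ltW.
have B0 : 0 <= B by rewrite addr_ge0// mulr_ge0// ltW.
have -> : (s * (f 0 * If1) + t * f 0) * (s' * (g 0 * Ig1) + t' * g 0) =
    c ^+ 2 * (A * B) by rewrite c2 /A /B; ring.
have le1 : c * ((A + B) / 2) <= (s + s') / 2 * Ih + (t + t') / 2 * h 0.
  rewrite Ih1E.
  have : (t + t') / 2 * c <= (t + t') / 2 * h 0.
    by rewrite ler_wpM2l// divr_ge0// addr_ge0.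
  have : c * (s * If1 + s' * Ig1) <= c * ((s + s') * Ih1).
    by rewrite ler_wpM2l// ltW.
  rewrite /A /B; lra.
(* AM-GM: A * B <= ((A + B) / 2)^2 *)
have : c ^+ 2 * (A * B) <= (c * ((A + B) / 2)) ^+ 2.
  rewrite exprMn ler_wpM2l ?sqr_ge0//.
  have := sqr_ge0 (A - B); rewrite !expr2; lra.
move=> /le_trans; apply; rewrite ler_pXn2r// nnegrE.
  by rewrite mulr_ge0 ?(ltW c0)// divr_ge0// addr_ge0.
apply: le_trans le1.
by rewrite mulr_ge0 ?(ltW c0)// divr_ge0// addr_ge0.
Qed.
End one_dimensional.

(** * Symmetric bodies in all dimensions and a Brunn-Minkowski inequality for [mixed] *)

Section bodies.
Context {R : realType}.
Local Notation RT := (measurableTypeR R).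
Local Notation mu := (@lebesgue_measure R).
Implicit Types (Q : seq R -> Prop) (s t : R).

(* A predicate on lists describes a body in every dimension at once: its lists
   of length k form its k-dimensional part. *)
Definition vol k Q : R := fine (lebesgue_tuple k [set y : k.-tuple RT | Q y]).

(** Since [all2] fails on lists of different lengths, solidity compares points of one dimension
    only. Convexity enters later, as a hypothesis relating three bodies. *)
Definition symmetric_body Q : Prop :=
  [/\ forall k, measurable [set y : k.-tuple RT | Q y],
      forall x y, all2 (fun a b => `|a| <= `|b|) x y -> Q y -> Q x,
      forall x y, perm_eq x y -> Q x -> Q y &
      exists M, forall x, Q x -> all (fun a => `|a| <= M) x].

Lemma symmetric_body_slice Q (u : R) :
  symmetric_body Q -> symmetric_body (fun y => Q (u :: y)).
Proof.
move=> [mQ solidQ permQ [M QM]]; split.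
- move=> k; rewrite -[X in measurable X]setTI.
  have mc : measurable_fun setT
      (fun y : k.-tuple RT => [tuple of (u : RT) :: y]).
    exact: (@measurable_cons _ _ (k.-tuple RT) RT (cst u) k id).
  exact: mc measurableT _ (mQ k.+1).
- by move=> x y xy; apply: solidQ; rewrite /= lexx.
- by move=> x y xy; apply: permQ; rewrite perm_cons.
- by exists M => x /QM /= /andP[].
Qed.

Lemma symmetric_body_pad Q j :
  symmetric_body Q -> symmetric_body (fun y => Q (nseq j 0 ++ y)).
Proof.
elim: j Q => [//|j IH] Q bQ; exact: IH (symmetric_body_slice 0 bQ).
Qed.

Lemma eq_vol k Q Q' :
  (forall y : k.-tuple R, Q y <-> Q' y) -> vol k Q = vol k Q'.
Proof.
by move=> QQ'; congr (fine (_ _)); apply/seteqP; split => y /QQ'.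
Qed.

Lemma lebesgue_tuple_fin k Q : symmetric_body Q ->
  (lebesgue_tuple k [set y : k.-tuple RT | Q y] < +oo)%E.
Proof.
move=> [mQ _ _ [M QM]].
pose A (i : 'I_k) : set RT := `[- M, M]%classic.
have mA i : measurable (A i) by exact: measurable_itv.
apply: (@le_lt_trans _ _ (lebesgue_tuple k [set t | forall i, A i (tnth t i)])).
  have mbox := measurable_box mA.
  apply: le_measure; rewrite ?inE; [exact: mQ|exact: mbox|].
  move=> y /= /QM /allP yM i; rewrite /A/= in_itv/= -ler_norml.
  by apply: yM; exact: mem_tnth.
rewrite lebesgue_tuple_box// ltey_eq; apply/orP; left.
apply: (big_ind (fun x : \bar R => x \is a fin_num)) => //.
  by move=> x y; exact: fin_numM.
by move=> i _; rewrite /A lebesgue_measure_itv/=; case: ifPn.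
Qed.

Lemma vol_ge0 k Q : 0 <= vol k Q.
Proof. exact: fine_ge0. Qed.

Lemma EFin_vol k Q : symmetric_body Q ->
  ((vol k Q)%:E = lebesgue_tuple k [set y : k.-tuple RT | Q y])%E.
Proof.
by move=> bQ; rewrite fineK// ge0_fin_numE//; exact: lebesgue_tuple_fin.
Qed.

Lemma le_vol k Q Q' : symmetric_body Q -> symmetric_body Q' ->
  (forall y, Q y -> Q' y) -> vol k Q <= vol k Q'.
Proof.
move=> bQ bQ' QQ'; rewrite -lee_fin !EFin_vol//.
case: bQ bQ' => [mQ _ _ _] [mQ' _ _ _].
by apply: le_measure; rewrite ?inE; [exact: mQ|exact: mQ'|move=> y /QQ'].
Qed.

Lemma vol0 Q : vol 0 Q = `[< Q [::] >]%:R.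
Proof.
pose A := [set y : 0.-tuple RT | Q y].
rewrite /vol (_ : lebesgue_tuple 0 A = \d_([tuple] : 0.-tuple RT) A)// diracE.
Qed.

Lemma vol_eq0 k Q : (forall y, ~ Q y) -> vol k Q = 0.
Proof.
move=> nQ; rewrite /vol (_ : [set _ | _] = set0) ?measure0//.
by apply/seteqP; split => y // /nQ.
Qed.

(** Cavalieri's principle: [lebesgue_tuple k.+1] is a product measure transported by [tcons], hence
    the integral of the measures of sections. *)
Lemma vol_slice k Q : symmetric_body Q ->
  measurable_fun setT (fun u : RT => vol k (fun y => Q (u :: y))) /\
  (\int[mu]_u (vol k (fun y => Q (u :: y)))%:E = (vol k.+1 Q)%:E)%E.
Proof.
move=> bQ; pose A := @tcons R k @^-1` [set y : k.+1.-tuple RT | Q y].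
have mA : measurable A.
  have [mQ _ _ _] := bQ; rewrite -[X in measurable X]setTI.
  exact: (@measurable_tcons R k measurableT _ (mQ k.+1)).
have E : EFin \o (fun u : RT => vol k (fun y => Q (u :: y))) =
    lebesgue_tuple k \o xsection A.
  apply/funext => u /=; rewrite EFin_vol; last exact: symmetric_body_slice.
  congr (lebesgue_tuple k _).
  by apply/seteqP; split => y; rewrite /xsection/= inE.
split.
  by apply/measurable_EFinP; rewrite E; exact: measurable_fun_xsection.
by rewrite EFin_vol//; apply: eq_integral => u _; have := congr1 (@^~ u) E.
Qed.

(* The mass of Q under the m-th power of the measure s * lebesgue + t * dirac 0,
   which for a symmetric body is the volume of sQ + (t/2)[-1,1]^m; working with
   this measure avoids Minkowski sums. *)
Definition mixed m s t Q : R := \sum_(k < m.+1)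
  ('C(m, k)%:R * s ^+ k * t ^+ (m - k)) *
  vol k (fun y => Q (nseq (m - k) 0 ++ y)).

Lemma mixed0 s t Q : mixed 0 s t Q = `[< Q [::] >]%:R.
Proof. by rewrite /mixed big_ord_recl big_ord0/= bin0 !mul1r addr0 vol0. Qed.

(** Fubini for the power measure behind [mixed]: the first coordinate is integrated against [s]
    times Lebesgue plus [t] times the Dirac mass at 0. For the explicit sum this is Pascal's
    rule. *)
Lemma mixed_slice m s t Q : symmetric_body Q -> 0 <= s -> 0 <= t ->
  exists I : R,
  [/\ measurable_fun setT (fun u : RT => mixed m s t (fun y => Q (u :: y))),
    (\int[mu]_u (mixed m s t (fun y => Q (u :: y)))%:E = I%:E)%E &
    mixed m.+1 s t Q = s * I + t * mixed m s t (fun y => Q (0 :: y))].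
Proof.
move=> bQ s0 t0.
pose c k := 'C(m, k)%:R * s ^+ k * t ^+ (m - k).
have c0 k : 0 <= c k by rewrite !mulr_ge0// exprn_ge0.
pose P j := fun y => Q (nseq j 0 ++ y).
have bP j : symmetric_body (P j) by exact: symmetric_body_pad.
(* Permutation invariance moves the free coordinate [u] past the padding zeros. *)
have QP j k u : vol k (fun y => Q (u :: nseq j 0 ++ y)) =
    vol k (fun y => P j (u :: y)).
  have [_ _ permQ _] := bQ.
  apply: eq_vol => y.
  have pu : perm_eq (u :: nseq j 0 ++ y) (nseq j 0 ++ u :: y).
    by rewrite -cat1s -[u :: y]cat1s perm_catCA.
  by split; apply: permQ; rewrite // perm_sym.
have mP j k : measurable_fun setT (fun u : RT => vol k (fun y => P j (u :: y))).
  by have [] := vol_slice k (bP j).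
exists (\sum_(k < m.+1) c k * vol k.+1 (P (m - k)%N)); split.
- rewrite /mixed; apply: measurable_sum => k; apply: measurable_funM => //.
  by under eq_fun do rewrite QP; exact: mP.
- rewrite /mixed; under eq_integral do rewrite -sumEFin.
  rewrite ge0_integral_sum//=.
  + rewrite -sumEFin; apply: eq_bigr => k _.
    under eq_integral do rewrite QP EFinM.
    rewrite ge0_integralZl//.
    * by rewrite (vol_slice k (bP _)).2.
    * exact/measurable_EFinP.
    * by move=> u _; rewrite lee_fin vol_ge0.
    * by rewrite lee_fin c0.
  + move=> k; apply/measurable_EFinP; apply: measurable_funM => //.
    by under eq_fun do rewrite QP; exact: mP.
  + by move=> k u _; rewrite lee_fin; exact: mulr_ge0 (c0 k) (vol_ge0 _ _).
- rewrite /mixed.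
  (* [a] collects the Dirac part and [b] the Lebesgue part; [b k] and [a k.+1] carry the same
     volume. *)
  pose a k := 'C(m, k)%:R * s ^+ k * t ^+ (m.+1 - k) * vol k (P (m.+1 - k)%N).
  pose b k := 'C(m, k)%:R * s ^+ k.+1 * t ^+ (m - k) * vol k.+1 (P (m - k)%N).
  have -> : t * (\sum_(k < m.+1) ('C(m, k)%:R * s ^+ k * t ^+ (m - k)) *
      vol k (fun y => Q (0 :: nseq (m - k) 0 ++ y))) = \sum_(k < m.+1) a k.
    rewrite mulr_sumr; apply: eq_bigr => k _.
    rewrite /a subSn -1?ltnS// exprS.
    by rewrite (_ : vol k _ = vol k (P (m - k).+1)) //; ring.
  have -> : s * (\sum_(k < m.+1) c k * vol k.+1 (P (m - k)%N)) =
      \sum_(k < m.+1) b k.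
    by rewrite mulr_sumr; apply: eq_bigr => k _; rewrite /b /c exprS; ring.
  rewrite big_ord_recl [\sum_(k < m.+1) a k]big_ord_recl /= addrCA.
  congr (_ + _); first by rewrite /a !bin0.
  (* The added term [a m.+1] is 0 because its binomial coefficient vanishes. *)
  have -> : \sum_(i < m) a (bump 0 i) = \sum_(i < m.+1) a i.+1.
    have am : a m.+1 = 0 by rewrite /a bin_small// !mul0r.
    by rewrite [RHS]big_ord_recr/= am addr0.
  rewrite -big_split/=; apply: eq_bigr => k _.
  by rewrite /a /b /bump /= add1n binS subSS natrD; ring.
Qed.

Lemma mixed_ge0 m s t Q : 0 <= s -> 0 <= t -> 0 <= mixed m s t Q.
Proof.
move=> s0 t0; apply: sumr_ge0 => k _.
by rewrite !mulr_ge0 ?exprn_ge0// vol_ge0.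
Qed.

Lemma le_mixed m s t Q Q' : 0 <= s -> 0 <= t ->
  symmetric_body Q -> symmetric_body Q' ->
  (forall y, Q y -> Q' y) -> mixed m s t Q <= mixed m s t Q'.
Proof.
move=> s0 t0 bQ bQ' QQ'; apply: ler_sum => k _; apply: ler_wpM2l.
  by rewrite !mulr_ge0 ?exprn_ge0.
by apply: le_vol => [||y /QQ'//]; exact: symmetric_body_pad.
Qed.

(** Solidity makes slices grow as the fixed coordinate shrinks in absolute value; boundedness
    empties the distant ones. *)
Lemma mixed_profile m s t Q : 0 <= s -> 0 <= t -> symmetric_body Q ->
  radial_profile (fun u => mixed m s t (fun y => Q (u :: y))).
Proof.
move=> s0 t0 bQ; have [_ solidQ _ [M QM]] := bQ; split.
- by have [I []] := mixed_slice m bQ s0 t0.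
- by move=> u; exact: mixed_ge0.
- move=> x y xy; apply: le_mixed => //; [exact: symmetric_body_slice..|].
  move=> z; apply: solidQ; rewrite /= xy/=.
  by elim: z => //= a z ->; rewrite lexx.
- exists M => x Mx; rewrite /mixed big1// => k _; rewrite vol_eq0 ?mulr0// => y.
  by move=> /QM /= /andP[]; rewrite leNgt Mx.
Qed.

(** Multiplicative Brunn-Minkowski, by induction on the dimension: [prekopa_leindler1] handles the
    first coordinate, and its pointwise hypothesis is the induction hypothesis for the slices. *)
Lemma prekopa_leindler_mixed m s s' t t' Q1 Q2 Q3 :
  0 < s -> 0 < s' -> 0 <= t -> 0 <= t' ->
  symmetric_body Q1 -> symmetric_body Q2 -> symmetric_body Q3 ->
  (forall x y, size x = m -> size y = m -> Q1 x -> Q2 y ->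
    Q3 [seq (s * z.1 + s' * z.2) / (s + s') | z <- zip x y]) ->
  mixed m s t Q1 * mixed m s' t' Q2 <=
    mixed m ((s + s') / 2) ((t + t') / 2) Q3 ^+ 2.
Proof.
move=> s0 s'0 t0 t'0.
have s20 : 0 <= (s + s') / 2 by rewrite divr_ge0// addr_ge0// ltW.
have t20 : 0 <= (t + t') / 2 by rewrite divr_ge0// addr_ge0.
elim: m Q1 Q2 Q3 => [|m IH] Q1 Q2 Q3 b1 b2 b3 Q123.
  rewrite !mixed0; do 2 case: asboolP => ?; rewrite ?mul0r ?mulr0 ?sqr_ge0//.
  by case: asboolP => [_|[]]; [rewrite expr1n mulr1|exact: (Q123 [::] [::])].
have [I1 [_ I1E ->]] := mixed_slice m b1 (ltW s0) t0.
have [I2 [_ I2E ->]] := mixed_slice m b2 (ltW s'0) t'0.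
have [I3 [_ I3E ->]] := mixed_slice m b3 s20 t20.
apply: (prekopa_leindler1 (f := fun u => mixed m s t (fun y => Q1 (u :: y)))
  (g := fun u => mixed m s' t' (fun y => Q2 (u :: y)))
  (h := fun u => mixed m _ _ (fun y => Q3 (u :: y)))) => //.
- exact: mixed_profile (ltW s0) t0 b1.
- exact: mixed_profile (ltW s'0) t'0 b2.
- exact: mixed_profile.
- move=> x y; apply: IH; [exact: symmetric_body_slice..|].
  by move=> v w vm wm Qv Qw; apply: (Q123 (x :: v) (y :: w)) => //=; congr S.
Qed.

End bodies.

(** * Second-order expansion of the Steiner polynomial *)

Section second_order.
Context {R : realType}.

(* Unlike these, hornerE also unfolds powers of scalars, which defeats ring. *)
Let horner_opE := (@hornerM R, @hornerD R, @hornerN R, @hornerC R, @hornerX R,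
  @hornerXn R, @hornerZ R, @horner_exp R).

Lemma horner_bounded01 (q : {poly R}) :
  exists B, 0 <= B /\ forall x, 0 <= x <= 1 -> `|q.[x]| <= B.
Proof.
exists (\sum_(i < size q) `|q`_i|); split; first exact: sumr_ge0.
move=> x /andP[x0 x1]; rewrite horner_coef.
apply: le_trans (ler_norm_sum _ _ _) _; apply: ler_sum => i _.
by rewrite normrM (ger0_norm (exprn_ge0 _ x0)) ler_piMr// exprn_ile1.
Qed.

Lemma expr_second_order (c : R) k : exists q : {poly R}, forall x,
  (1 - c * x) ^+ k =
  1 - k%:R * c * x + 'C(k, 2)%:R * c ^+ 2 * x ^+ 2 + x ^+ 3 * q.[x].
Proof.
elim: k => [|k [q IH]].
  by exists 0 => x; rewrite horner0 expr0 bin0n/=; ring.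
exists (q * (1 - c%:P * 'X) - ('C(k, 2)%:R * c ^+ 3)%:P) => x.
by rewrite exprS IH !horner_opE binS bin1 natrD -(natr1 k); ring.
Qed.

(** The coefficient of [x ^+ 2] is [4 * a * k] on the left of the hypothesis and [2 * a * k] on the
    right, the constant terms being equal. A positive [k] is impossible for small [x]. *)
Lemma second_order_nonpos (a k : R) (u : R -> R) (q : {poly R}) (e : R) :
  0 < a -> 0 < e ->
  (forall x, u x = a + k * x ^+ 2 + x ^+ 3 * q.[x]) ->
  (forall x, 0 < x < e -> a * u (2 * x) <= u x ^+ 2) ->
  k <= 0.
Proof.
move=> a0 e0 uE u2; rewrite leNgt; apply/negP => k0.
have [B [B0 qB]] := horner_bounded01 q.
pose C := 10 * a * B + k ^+ 2 + 2 * k * B + B ^+ 2.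
have C0 : 0 <= C by rewrite !addr_ge0 ?mulr_ge0 ?exprn_ge0// ltW.
have C1 : 0 < C + 1 by lra.
have ak : 0 < a * k by exact: mulr_gt0.
(* The three bounds give [x < e], keep [2 * x] in the unit interval where [B] bounds [q], and make
   [x * C] too small for [2 * a * k <= x * C]. *)
pose x := Num.min (e / 2) (Num.min 2^-1 (a * k / (C + 1))).
have x0 : 0 < x.
  by rewrite !lt_min invr_gt0 ltr0n (divr_gt0 ak C1) divr_gt0.
have xe : x < e.
  by apply: (@le_lt_trans _ _ (e / 2)); [rewrite ge_min lexx|lra].
have x12 : x <= 2^-1 by rewrite !ge_min lexx orbT.
have xC : x * (C + 1) <= a * k.
  by rewrite -ler_pdivlMr// !ge_min lexx !orbT.
have := u2 x; rewrite x0 xe => /(_ isT); rewrite !uE.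
have /qB : 0 <= x <= 1 by lra.
have /qB : 0 <= 2 * x <= 1 by lra.
set p := q.[2 * x]; set r := q.[x] => pB rB main.
have {}main : 2 * a * k * x ^+ 2 <= x ^+ 3 * (2 * a * r + k ^+ 2 * x +
    2 * k * x ^+ 2 * r + x ^+ 3 * r ^+ 2 - 8 * a * p).
  by rewrite -subr_ge0 in main; rewrite -subr_ge0; congr (0 <= _): main; ring.
have {}main : 2 * a * k <= x * (2 * a * r + k ^+ 2 * x +
    2 * k * x ^+ 2 * r + x ^+ 3 * r ^+ 2 - 8 * a * p).
  rewrite -(@ler_pM2r _ (x ^+ 2)) ?exprn_gt0//; apply: le_trans main _.
  by rewrite le_eqVlt; apply/orP; left; apply/eqP; ring.
have x1 : x <= 1 by lra.
have xn j : 0 <= x ^+ j <= 1.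
  by rewrite exprn_ge0 ?(ltW x0)// exprn_ile1 ?(ltW x0).
have le : 2 * a * r + k ^+ 2 * x + 2 * k * x ^+ 2 * r + x ^+ 3 * r ^+ 2 -
    8 * a * p <= C.
  have h1 : a * r <= a * B.
    by rewrite ler_wpM2l ?(ltW a0)// (le_trans (ler_norm _)).
  have h2 : k ^+ 2 * x <= k ^+ 2 by rewrite ler_piMr ?exprn_ge0// ltW.
  have h3 : k * (x ^+ 2 * r) <= k * B.
    rewrite ler_wpM2l ?(ltW k0)//; apply: le_trans (ler_norm _) _.
    have /andP[y0 y1] := xn 2.
    by rewrite normrM ger0_norm// (le_trans _ rB)// ler_piMl.
  have h4 : x ^+ 3 * r ^+ 2 <= B ^+ 2.
    have /andP[y0 y1] := xn 3.
    apply: (@le_trans _ _ (r ^+ 2)); first by rewrite ler_piMl// sqr_ge0.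
    by rewrite -real_normK ?num_real// ler_pXn2r// nnegrE.
  have h5 : a * - p <= a * B.
    by rewrite ler_wpM2l ?(ltW a0)// (le_trans (ler_norm _))// normrN.
  by rewrite /C; lra.
have : 2 * a * k <= x * C by apply: le_trans main _; rewrite ler_pM2l.
have : 0 < a * k by exact: mulr_gt0.
by lra.
Qed.

Definition steiner m (a : nat -> R) (s t : R) : R :=
  \sum_(k < m.+1) ('C(m, k)%:R * s ^+ k * t ^+ (m - k)) * a k.

(** The linear coefficient is [n.+2 * (a n.+1 - c * a n.+2)], which the hypothesis makes 0; the same
    relation simplifies the quadratic one. *)
Lemma steiner_second_order n (a : nat -> R) (c : R) :
  a n.+1 = c * a n.+2 ->
  exists q : {poly R}, forall x, steiner n.+2 a (1 - c * x) x =
    a n.+2 + 'C(n.+2, 2)%:R * (a n - c * a n.+1) * x ^+ 2 + x ^+ 3 * q.[x].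
Proof.
move=> ac.
have [q0 q0E] := expr_second_order c n.
have [q1 q1E] := expr_second_order c n.+1.
have [q2 q2E] := expr_second_order c n.+2.
(* The terms with [k < n] are divisible by [x ^+ 3]; [r] is their quotient. The witness adds the
   cubic remainders of the last three terms. *)
pose r : {poly R} := \sum_(k < n)
  ('C(n.+2, k)%:R * a k) *: ((1 - c *: 'X) ^+ k * 'X^(n.-1 - k)).
pose N : R := n%:R.
pose M : R := 'C(n.+1, 2)%:R.
exists (r + ('C(n.+2, 2)%:R * a n) *:
    ((- N * c)%:P + ('C(n, 2)%:R * c ^+ 2) *: 'X + 'X^2 * q0)
  + (n.+2%:R * a n.+1) *: ((M * c ^+ 2)%:P + 'X * q1) + a n.+2 *: q2) => x.
rewrite /steiner !big_ord_recr/= subnn subSnn.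
rewrite (_ : n.+2 - n = 2)%N; last by rewrite -[n.+2]addn2 addKn.
have -> : \sum_(i < n)
    'C(n.+2, i)%:R * (1 - c * x) ^+ i * x ^+ (n.+2 - i) * a i = x ^+ 3 * r.[x].
  rewrite horner_sum mulr_sumr; apply: eq_bigr => k _.
  rewrite (_ : n.+2 - k = 3 + (n.-1 - k))%N; last first.
    by have := ltn_ord k; lia.
  by rewrite !horner_opE exprD; ring.
have b2 : 'C(n.+2, n) = 'C(n.+2, 2).
  by rewrite -(@bin_sub n.+2 2)// !subSS subn0.
rewrite binn b2 binSn q0E q1E q2E !horner_opE.
have d2 : n.+2%:R * n.+1%:R = 'C(n.+2, 2)%:R * 2 :> R.
  rewrite -!natrM; congr (_%:R).
  by have := bin_ffact n.+2 2; rewrite ffactSS ffactn1.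
rewrite ac /N /M.
apply/eqP; rewrite -subr_eq0; apply/eqP.
transitivity (('C(n.+2, 2)%:R * 2 - n.+2%:R * n.+1%:R) *
  (c ^+ 2 * a n.+2 * x ^+ 2)).
  ring.
by rewrite d2 subrr mul0r.
Qed.
End second_order.

Lemma nth_cat_nseq0 (V : nmodType) (s : seq V) k i : (s ++ nseq k 0)`_i = s`_i.
Proof.
rewrite nth_cat; case: ltnP => // si; rewrite nth_nseq if_same.
by rewrite nth_default.
Qed.

(** * The symmetric body of lists attached to [K], and log-concavity of its volumes *)

Section convex_body_sections.
Context {R : realType}.
Local Notation RT := (measurableTypeR R).
Context (n : nat) (K : set 'rV[R]_n).
Context (hK : convex_body K) (hKu : unconditional K) (hKp : perm_invariant K).

Lemma convex_body_conv (x y : 'rV[R]_n) (l : R) : 0 <= l <= 1 ->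
  K x -> K y -> K (l *: x + (1 - l) *: y).
Proof.
case: hK => _ cK _ /andP[l0 l1] Kx Ky.
have /mem_set xK := Kx; have /mem_set yK := Ky.
have := cK x y (Itv01 l0 l1) xK yK; rewrite inE.
by [].
Qed.

(** Coordinates of [x] are replaced by those of [y] one at a time; each new point lies on the
    segment from the old one to its reflection in that coordinate. *)
Lemma convex_body_solid (x y : 'rV[R]_n) :
  (forall i, `|y 0 i| <= `|x 0 i|) -> K x -> K y.
Proof.
move=> yx Kx.
pose z j : 'rV[R]_n := \row_i (if (i < j)%N then y 0 i else x 0 i).
suff Kz j : K (z j).
  by have := Kz n; congr K; apply/rowP => i; rewrite mxE ltn_ord.
elim: j => [|j Kj].
  by move: Kx; congr K; apply/rowP => i; rewrite mxE.
have [nj|jn] := leqP n j.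
  move: Kj; congr K; apply/rowP => i; rewrite !mxE.
  by rewrite !(leq_trans (ltn_ord i))// leqW.
pose i0 := Ordinal jn.
pose w : 'rV[R]_n := \row_i ((if i == i0 then -1 else 1) * z j 0 i).
have Kw : K w by apply: hKu => // i; case: eqP; [left|right].
have [x0|x0] := eqVneq (x 0 i0) 0.
  move: Kj; congr K; apply/rowP => i.
  rewrite !mxE [in RHS]ltnS [in RHS]leq_eqVlt.
  have [ij|//] := eqVneq (i : nat) j.
  have -> : i = i0 by exact: val_inj.
  rewrite ltnn/= x0; apply/esym/eqP; rewrite -normr_le0.
  by have := yx i0; rewrite x0 normr0.
(* Solves [l * x - (1 - l) * x = y] in coordinate [i0]. *)
pose l := (1 + y 0 i0 / x 0 i0) / 2.
have yx1 : `|y 0 i0 / x 0 i0| <= 1.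
  by rewrite normrM normfV ler_pdivrMr ?normr_gt0// mul1r.
have l01 : 0 <= l <= 1 by move: yx1; rewrite ler_norml /l; lra.
have := convex_body_conv l01 Kj Kw; congr K; apply/rowP => i; rewrite !mxE.
have [->|ii0] := eqVneq i i0.
  by rewrite /= ltnn ltnSn /l; field.
have ij : (i : nat) != j by apply: contra ii0 => /eqP ij; apply/eqP/val_inj.
by rewrite [in RHS]ltnS [in RHS]leq_eqVlt (negbTE ij)/=; ring.
Qed.

Definition row_of_seq (s : seq R) : 'rV[R]_n := \row_(i < n) s`_i.

(** The default value 0 of [nth] pads short lists, so lists of length [k] describe a coordinate
    section of [K]. The size bound excludes lists that [row_of_seq] would truncate. *)
Definition seq_body (s : seq R) : Prop := (size s <= n)%N /\ K (row_of_seq s).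

(** Padding both lists with zeros to length [n] turns the rearrangement into an element of
    ['S_n]. *)
Lemma seq_body_perm (x y : seq R) : perm_eq x y -> seq_body x -> seq_body y.
Proof.
move=> xy [xn Kx]; have sxy := perm_size xy; split; first by rewrite -sxy.
have yn : size (y ++ nseq (n - size y) 0) = n.
  by rewrite size_cat size_nseq subnKC// -sxy.
have xn' : size (x ++ nseq (n - size y) 0) = n.
  by rewrite size_cat size_nseq -sxy subnKC.
pose X : n.-tuple R := Tuple (introT eqP xn').
have /tuple_permP[p yp] : perm_eq (y ++ nseq (n - size y) 0) X.
  by rewrite perm_sym perm_cat2r.
have := hKp p Kx; congr K; apply/rowP => i; rewrite !mxE.
rewrite -[LHS](nth_cat_nseq0 _ (n - size y)).
rewrite -[RHS](nth_cat_nseq0 _ (n - size y)) yp.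
by rewrite -tnth_nth tnth_mktuple (tnth_nth 0).
Qed.

Lemma seq_body_bounded : exists M, forall x, seq_body x ->
  all (fun a => `|a| <= M) x.
Proof.
case: hK => cK _ _; have [M [_ MK]] := compact_bounded cK.
exists (M + 1) => x [xn Kx].
have := MK (M + 1); rewrite ltrDl ltr01 => /(_ isT _ Kx) /= xM.
apply/(all_nthP 0) => i ix; apply: le_trans xM.
rewrite -[leRHS]/(mx_norm (row_of_seq x)) mx_normrE.
have -> : x`_i = row_of_seq x 0 (Ordinal (leq_trans ix xn)) by rewrite mxE.
exact: (@le_bigmax _ _ _ 0 (fun ij => `|row_of_seq x ij.1 ij.2|) (0, _)).
Qed.

(** [K] is closed, so its complement is a countable union of boxes with rational centres and radii,
    each in the product sigma-algebra. *)
Lemma measurable_convex_body :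
  measurable [set t : n.-tuple RT | K (\row_i tnth t i)].
Proof.
have cK : closed K.
  by case: hK => cK _ _; apply: compact_closed => //; exact: norm_hausdorff.
pose box (q : 'rV[rat]_n * rat) := [set t : n.-tuple RT |
  forall i, ball (ratr (q.1 0 i) : R) (ratr q.2) (tnth t i)].
pose S := [set q | forall t, box q t -> ~ K (\row_i tnth t i)].
have -> : [set t : n.-tuple RT | K (\row_i tnth t i)] =
    ~` (\bigcup_q (if `[< S q >] then box q else set0)).
  apply/seteqP; split => t /=.
    by move=> Kt [q _]; case: asboolP => // Sq /Sq.
  move=> nt; apply: contrapT => nK; apply: nt.
  have : (~` K) (\row_i tnth t i) by [].
  have := closed_openC cK; rewrite openE => /[apply] /nbhs_ballP[e /= e0 eK].
  have e40 : 0 < e / 4 by rewrite divr_gt0.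
  have e42 : e / 4 < e / 2 by lra.
  (* A centre within [e / 4] of [t] and a radius between [e / 4] and [e / 2] give a box containing
     [t] and inside its [e]-ball. *)
  have [r] := rat_in_itvoo e42; rewrite in_itv/= => /andP[r1 r2].
  have qs i : exists q : rat, ball (tnth t i) (e / 4) (ratr q : R).
    have te : tnth t i - e / 4 < tnth t i + e / 4 by lra.
    have [q] := rat_in_itvoo te; rewrite in_itv/= => /andP[q1 q2].
    by exists q; rewrite /ball/= ltr_distlC q1 q2.
  have [q qP] := choice qs.
  exists (\row_i q i, r) => //=; case: asboolP => [_ i|nS].
    rewrite /= mxE; apply: ball_sym; apply: le_ball (qP i); exact: ltW.
  exfalso; apply: nS => u /= ub; apply: eK; split => // a b.
  rewrite !ord1 !mxE.
  have -> : e = e / 2 + e / 2 by lra.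
  have b1 : ball (tnth t b : R) (e / 2) (ratr (q b) : R).
    by apply: le_ball (qP b); lra.
  have b2 : ball (ratr (q b) : R) (e / 2) (tnth u b : R).
    by have := ub b; rewrite mxE; apply: le_ball; exact: ltW.
  exact: ball_triangle b1 b2.
apply: measurableC; apply: countable_bigcupT_measurable.
  exact: countableP.
move=> q; case: asboolP => // _.
apply: (@measurable_box R n (fun i => ball (ratr (q.1 0 i) : R) (ratr q.2))).
by move=> i; exact: measurable_ball.
Qed.

Lemma symmetric_seq_body : symmetric_body seq_body.
Proof.
split.
- move=> k; have [kn|nk] := leqP k n; last first.
    rewrite (_ : [set _ | _] = set0)//; apply/seteqP; split => y // -[].
    by rewrite size_tuple leqNgt nk.
  pose f (y : k.-tuple RT) : n.-tuple RT := [tuple (y : seq R)`_i | i < n].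
  have mf : measurable_fun setT f.
    apply/measurable_fun_tnthP => i; rewrite /comp.
    under eq_fun do rewrite tnth_mktuple.
    have [ik|ki] := ltnP i k.
      under eq_fun do rewrite -(tnth_nth 0 _ (Ordinal ik)).
      exact: measurable_tnth.
    under eq_fun do rewrite nth_default ?size_tuple//.
    exact: measurable_cst.
  have := mf measurableT _ measurable_convex_body; rewrite setTI.
  congr measurable; apply/seteqP; split => y /=.
    move=> Ky; split; first by rewrite size_tuple.
    by move: Ky; congr K; apply/rowP => i; rewrite !mxE tnth_mktuple.
  by move=> [_]; congr K; apply/rowP => i; rewrite !mxE tnth_mktuple.
- move=> x y xy [yn Ky].
  have sxy : size x = size y by move: xy; rewrite all2E => /andP[/eqP].
  split; first by rewrite sxy.
  apply: convex_body_solid Ky => // i; rewrite !mxE.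
  have [ix|xi] := ltnP i (size x); last by rewrite !nth_default// -?sxy.
  elim: x y {sxy yn} (i : nat) xy ix => [|a x IH] [|b y] [|j]//= /andP[]//.
  by move=> _; exact: IH.
- exact: seq_body_perm.
- exact: seq_body_bounded.
Qed.

(** Projecting only shrinks coordinates, so by solidity the projection of [K] equals its section. *)
Lemma volume_coord_proj i : (i <= n)%N ->
  volume (coord_proj i K) = vol i seq_body.
Proof.
move=> le_in; congr (fine (lebesgue_tuple i _)).
have incl (t : i.-tuple R) : coord_incl n (\row_j tnth t j) = row_of_seq t.
  apply/rowP => j; rewrite !mxE; case: insubP => [k _ kj|].
    by rewrite mxE (tnth_nth 0) kj.
  by rewrite -leqNgt => ij; rewrite nth_default// size_tuple.
apply/seteqP; split => t; rewrite /coord_proj/= incl.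
  move=> [x Kx tx]; split; first by rewrite size_tuple.
  rewrite -tx; apply: convex_body_solid Kx => // j; rewrite mxE.
  by case: ifP; rewrite ?normr0.
move=> [_ Kt]; exists (row_of_seq t) => //; apply/rowP => j; rewrite !mxE.
by case: ltnP => // ij; rewrite nth_default// size_tuple.
Qed.

(** For an interior point [x] and small [z], both [x + z] and, by reflection, [- (x - z)] lie in
    [K]; their midpoint is [z]. *)
Lemma convex_body_cube : exists e, 0 < e /\
  forall z : 'rV[R]_n, (forall i, `|z 0 i| <= e) -> K z.
Proof.
have [_ _ [x]] := hK; rewrite /interior => /nbhs_ballP[e /= e0 eK].
exists (e / 2); split; first by rewrite divr_gt0.
move=> z ze.
have near (w : 'rV[R]_n) : (forall i, `|w 0 i| <= e / 2) -> K (x + w).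
  move=> we; apply: eK; split => // a b; rewrite !ord1 !mxE /ball/=.
  by rewrite opprD addrA subrr add0r normrN; apply: le_lt_trans (we b) _; lra.
have Kxz := near z ze.
have Knz : K (x - z) by apply: near => i; rewrite mxE normrN.
have Kzx : K (- (x - z)).
  have := hKu (eps := fun=> -1) (fun=> or_introl erefl) Knz.
  by congr K; apply/rowP => i; rewrite !mxE; ring.
have h01 : 0 <= (2^-1 : R) <= 1 by lra.
have := convex_body_conv h01 Kxz Kzx; congr K.
by apply/rowP => i; rewrite !mxE; field.
Qed.

Lemma vol_seq_body_gt0 k : (k <= n)%N -> 0 < vol k seq_body.
Proof.
move=> kn; have [e [e0 eK]] := convex_body_cube.
rewrite -lte_fin EFin_vol; last exact: symmetric_seq_body.
pose A (i : 'I_k) : set RT := `[- e, e]%classic.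
have mA i : measurable (A i) by exact: measurable_itv.
apply: (@lt_le_trans _ _ (lebesgue_tuple k [set t | forall i, A i (tnth t i)])).
  rewrite lebesgue_tuple_box//.
  apply: (big_ind (fun x : \bar R => 0%R < x)%E) => //.
    by move=> x y; exact: mule_gt0.
  move=> i _; rewrite /A lebesgue_measure_itv/= lte_fin gtrN// -EFinB lte_fin.
  by lra.
have mbox := measurable_box mA; have [mQ _ _ _] := symmetric_seq_body.
apply: le_measure; rewrite ?inE; [exact: mbox|exact: mQ|] => t /= tA.
split; first by rewrite size_tuple.
apply: eK => i; rewrite mxE; have [ik|ki] := ltnP i k.
  by have := tA (Ordinal ik); rewrite /A/= in_itv/= -ler_norml (tnth_nth 0).
by rewrite nth_default ?size_tuple// normr0 ltW.
Qed.

Lemma mixed_seq_body m s t : (m <= n)%N ->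
  mixed m s t seq_body = steiner m (fun k => vol k seq_body) s t.
Proof.
move=> mn; apply: eq_bigr => k _; congr (_ * _); apply: eq_vol => y.
have km : (k <= m)%N by rewrite -ltnS.
have row_pad : row_of_seq (y ++ nseq (m - k) 0) = row_of_seq y.
  by apply/rowP => i; rewrite !mxE nth_cat_nseq0.
split.
  move=> Qy; have [] : seq_body (y ++ nseq (m - k) 0).
    by apply: seq_body_perm Qy => //; rewrite perm_catC.
  by rewrite row_pad => _ Ky; split => //; rewrite size_tuple (leq_trans km).
move=> [_ Ky]; apply: (@seq_body_perm (y ++ nseq (m - k) 0)).
  by rewrite perm_catC.
by split; rewrite ?row_pad// size_cat size_nseq size_tuple subnKC.
Qed.

Lemma seq_body_conv m (s t : R) (x y : seq R) : 0 < s -> 0 < t ->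
  size x = m -> size y = m -> seq_body x -> seq_body y ->
  seq_body [seq (s * z.1 + t * z.2) / (s + t) | z <- zip x y].
Proof.
move=> s0 t0 xm ym [xn Kx] [yn Ky].
have szip : size (zip x y) = m by rewrite size_zip xm ym minnn.
split; first by rewrite size_map szip -xm.
have st0 : 0 < s + t by exact: addr_gt0.
have l01 : 0 <= s / (s + t) <= 1.
  by rewrite divr_ge0 ?(ltW s0) ?(ltW st0)//= ler_pdivrMr// mul1r lerDl ltW.
have := convex_body_conv l01 Kx Ky; congr K; apply/rowP => i; rewrite !mxE.
have [im|mi] := ltnP i m; last first.
  by rewrite !nth_default ?size_map ?szip ?xm ?ym// !mulr0 addr0.
rewrite (nth_map (0, 0)) ?szip// nth_zip ?xm//=.
by field; rewrite gt_eqF.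
Qed.

Lemma vol_seq_body_log_concave p : (p.+2 <= n)%N ->
  vol p seq_body * vol p.+2 seq_body <= vol p.+1 seq_body ^+ 2.
Proof.
move=> pn; pose a k := vol k seq_body; rewrite -!/(a _).
have ap0 : 0 < a p.+2 by exact: vol_seq_body_gt0.
have ap1 : 0 < a p.+1 by apply: vol_seq_body_gt0; exact: ltnW.
pose c := a p.+1 / a p.+2.
have c0 : 0 < c by exact: divr_gt0.
have ac : a p.+1 = c * a p.+2 by rewrite divfK// gt_eqF.
have [q qE] := steiner_second_order ac.
(* This bound on [x] keeps the weight [1 - 2cx] positive. *)
have e0 : 0 < (2 * c)^-1 by rewrite invr_gt0 mulr_gt0.
have : 'C(p.+2, 2)%:R * (a p - c * a p.+1) <= 0.
  apply: (second_order_nonpos ap0 e0 qE) => x /andP[x0 xe].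
  have s0 : 0 < 1 - c * (2 * x).
    rewrite subr_gt0; move: xe.
    rewrite -div1r ltr_pdivlMr; last exact: mulr_gt0.
    by lra.
  have x20 : 0 <= 2 * x by rewrite mulr_ge0// ltW.
  have bQ := symmetric_seq_body.
  (* The weights [(1, 0)] and [(1 - 2cx, 2x)] have mean [(1 - cx, x)], so the expansion is compared
     at 0, [2 * x] and [x]. *)
  have := prekopa_leindler_mixed (m := p.+2) ltr01 s0 (lexx 0) x20 bQ bQ bQ
    (fun x y xm ym => seq_body_conv ltr01 s0 xm ym).
  rewrite !mixed_seq_body//.
  have -> : (1 + (1 - c * (2 * x))) / 2 = 1 - c * x by field.
  have -> : (0 + 2 * x) / 2 = x by field.
  rewrite (_ : steiner _ _ 1 0 = a p.+2)//.
  rewrite /steiner big_ord_recr/= subnn binn expr1n expr0 !mul1r.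
  rewrite big1 ?add0r// => k _.
  by rewrite expr0n subn_eq0 leqNgt ltn_ord/= mulr0 mul0r.
have b0 : 0 < 'C(p.+2, 2)%:R :> R by rewrite ltr0n bin_gt0.
(* Multiply [a p <= c * a p.+1] by [a p.+2] and use [c * a p.+2 = a p.+1]. *)
rewrite pmulr_rle0// subr_le0 => /(ler_wpM2r (ltW ap0)) /le_trans; apply.
by rewrite [in leRHS]expr2 {3}ac; lra.
Qed.

End convex_body_sections.

Unset Implicit Arguments.

Theorem theorem1 (R : realType) (n : nat) (hn : (3 <= n)%N)
    (K : set 'rV[R]_n) (hK : convex_body K) (hKu : unconditional K)
    (hKp : perm_invariant K) :
  log_concave n (fun i => volume (coord_proj i K)) /\
  volume K * volume (coord_proj (n - 2) K) <=
    volume (coord_proj (n - 1) K) ^+ 2.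
Proof.
have vE := volume_coord_proj hK hKu.
have main i : (2 <= i <= n.-1)%N ->
    volume (coord_proj i.-1 K) * volume (coord_proj i.+1 K) <=
      volume (coord_proj i K) ^+ 2.
  case: i => // i /andP[_ i_n]; rewrite !vE; [|lia..].
  by apply: vol_seq_body_log_concave => //; lia.
split.
  split=> // i /andP[_ i_n]; rewrite vE//; exact: vol_seq_body_gt0.
(* Reading [K] as its own [n]-th projection makes the last claim the case [i = n.-1]. *)
rewrite -[X in volume X * _]coord_proj_id mulrC subn1 subn2.
have := main n.-1; rewrite prednK; last by lia.
by apply; lia.
Qed.
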